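(* Let $\mathbb{F}$ be a field of characteristic $0$, let $n\in\mathbb{N}$, $\varkappa=(\varkappa_1,\ldots,\varkappa_n)\in\mathbb{N}^n$ (all $\varkappa_j\ge 1$), and $m\in\mathbb{N}_0$. Then the following identity holds in the field of rational functions $\mathbb{F}(y_1,\ldots,y_n)$: \[ \operatorname{h}_m(y^{[\varkappa]})=\sum_{s=1}^{n}\sum_{r=1}^{\varkappa_s} A_{y,\varkappa,s,r}\binom{m+r-1}{r-1}\,y_s^m . \] As a consequence, the same identity holds when $y_1,\ldots,y_n$ are pairwise different elements of $\mathbb{F}$.
   Context: For variables $x_1,\ldots,x_N$ and $m\in\mathbb{N}_0$, the complete homogeneous polynomial is $\operatorname{h}_m(x_1,\ldots,x_N)=\sum_{k\in\mathbb{N}_0^N,\ k_1+\cdots+k_N=m} x_1^{k_1}\cdots x_N^{k_N}$ (so $\operatorname{h}_0=1$). For $\varkappa\in\mathbb{N}_0^n$, $y^{[\varkappa]}$ denotes the list of length $|\varkappa|=\varkappa_1+\cdots+\varkappa_n$ consisting of $y_1$ repeated $\varkappa_1$ times, then $y_2$ repeated $\varkappa_2$ times, ..., then $y_n$ repeated $\varkappa_n$ times. For $s\in\{1,\ldots,n\}$ and $r\in\{1,\ldots,\varkappa_s\}$, define \[ A_{y,\varkappa,s,r}=\frac{(-y_s)^{|\varkappa|-\varkappa_s}}{\prod_{d\in\{1,\ldots,n\}\setminus\{s\}}(y_d-y_s)^{\varkappa_d}}\;\operatorname{h}_{\varkappa_s-r}(w), \] where $w$ is the list of length $|\varkappa|-\varkappa_s$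 obtained by listing, for $d=1,\ldots,n$ with $d\ne s$ in increasing order, the element $y_d/(y_d-y_s)$ repeated $\varkappa_d$ times. *)

(* Defs.v *)
From mathcomp Require Export all_boot all_order all_algebra.
From mathcomp.multinomials Require Export mpoly.

Set Implicit Arguments.
Unset Strict Implicit.
Unset Printing Implicit Defensive.

Import GRing.Theory.
Local Open Scope ring_scope.

(* h_m(x_1, ..., x_N).  Requiring [mdeg k == m] makes the degree bound [m.+1]
   harmless: it only turns the set of exponents into a finite type. *)
Definition hcomp (R : comNzRingType) (m : nat) (x : seq R) : R :=
  \sum_(k : 'X_{1..(size x) < m.+1} | mdeg k == m)
     \prod_(i < size x) x`_i ^+ k i.

(* y^[kappa] *)
Definition rep_list (T : Type) (n : nat) (kappa : 'I_n -> nat)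
    (y : 'I_n -> T) : seq T :=
  flatten [seq nseq (kappa d) (y d) | d <- enum 'I_n].

Definition hweight (n : nat) (kappa : 'I_n -> nat) : nat :=
  (\sum_(d < n) kappa d)%N.

(* A_{y,kappa,s,r}, meant for [0 < r <= kappa s] only. *)
Definition Acoef (K : fieldType) (n : nat) (y : 'I_n -> K)
    (kappa : 'I_n -> nat) (s : 'I_n) (r : nat) : K :=
  let w := flatten [seq nseq (kappa d) (y d / (y d - y s))
                   | d <- enum 'I_n & d != s] in
  (- y s) ^+ (hweight kappa - kappa s)
    / (\prod_(d < n | d != s) (y d - y s) ^+ kappa d)
    * hcomp (kappa s - r) w.

(* Main.v *)
(* Both sides of the identity, as functions of kappa, satisfy the recurrence
     (y_a - y_b) X(kappa) = y_a X(kappa - e_b) - y_b X(kappa - e_a)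
   whenever a <> b and kappa_a, kappa_b > 0; for the left-hand side this is
     (a - b) / ((1 - a t) (1 - b t)) = a / (1 - a t) - b / (1 - b t).
   On the right-hand side it already holds for each s separately.  Induction
   on |kappa|, allowing zero entries, reduces to kappa supported on a single s,
   where both sides equal binom(m + kappa_s - 1, kappa_s - 1) y_s^m. *)

Require Import Defs.
From mathcomp Require Import all_boot all_order all_algebra.
From mathcomp.multinomials Require Import mpoly.
From mathcomp Require Import ring.

Import GRing.Theory.
Local Open Scope ring_scope.

(** * Complete homogeneous polynomials via truncated geometric series *)

Definition geom_poly {R : comNzRingType} (N : nat) (a : R) : {poly R} :=
  \sum_(i < N.+1) a ^+ i *: 'X^i.

Lemma geom_polyE (R : comNzRingType) (N : nat) (a : R) :
  (1 - a *: 'X) * geom_poly N a = 1 - (a *: 'X) ^+ N.+1.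
Proof.
have -> : geom_poly N a = \sum_(i < N.+1) (a *: 'X) ^+ i.
  by apply: eq_bigr => i _; rewrite exprZn.
by rewrite -[RHS]opprB subrX1 -mulNr opprB.
Qed.

(** Exponents adding up to [m] are at most [N], so the bound [N] loses nothing. Finite functions are
    the index set that arises when a product of sums is distributed. *)
Lemma hcomp_ffun (R : comNzRingType) (N m : nat) (x : seq R) :
  (m <= N)%N ->
  hcomp m x =
    \sum_(f : {ffun 'I_(size x) -> 'I_N.+1} | (\sum_(i < size x) f i)%N == m)
       \prod_(i < size x) x`_i ^+ f i.
Proof.
move=> le_mN; rewrite /hcomp.
have bP : (mdeg (0%MM : 'X_{1..size x}) < m.+1)%N by rewrite mdeg0.
(* The default, the zero multinomial, is reached only when the values of [f] add up to more than
   [m]. *)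
pose h (f : {ffun 'I_(size x) -> 'I_N.+1}) : 'X_{1..(size x) < m.+1} :=
  insubd (BMultinom bP) [multinom (f i : nat) | i < size x].
pose h' (k : 'X_{1..(size x) < m.+1}) : {ffun 'I_(size x) -> 'I_N.+1} :=
  [ffun i => inord (k i)].
have le_deg (k : 'X_{1..(size x)}) i : (k i <= mdeg k)%N.
  by rewrite mdegE (bigD1 i) //= leq_addr.
have hE (f : {ffun 'I_(size x) -> 'I_N.+1}) : (\sum_(i < size x) f i)%N = m ->
    h f = [multinom (f i : nat) | i < size x] :> 'X_{1..size x}.
  move=> fm; rewrite /h insubdK // -topredE /= mdegE.
  by under eq_bigr do rewrite mnmE; rewrite fm.
have h'E (k : 'X_{1..(size x) < m.+1}) i : mdeg k = m -> h' k i = k i :> nat.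
  by move=> km; rewrite ffunE inordK // ltnS (leq_trans (le_deg k i)) // km.
rewrite (reindex_onto h h') /=; last first.
  move=> k /eqP km; apply/val_inj => /=.
  rewrite -[LHS]/(bmnm (h (h' k))) hE.
    by apply/mnmP => i; rewrite mnmE h'E.
  by under eq_bigr do rewrite h'E //; rewrite -mdegE.
apply: eq_big => [f|f /andP[/eqP km /eqP fE]].
  apply/andP/eqP => [[/eqP km /eqP fE]|fm].
    by rewrite -[in LHS]fE -km mdegE; apply: eq_bigr => i _; rewrite h'E.
  have km : mdeg (h f) = m.
    by rewrite hE // mdegE; under eq_bigr do rewrite mnmE.
  rewrite km; split=> //; apply/eqP/ffunP => i; apply/val_inj.
  by rewrite /= h'E // hE // mnmE.
by apply: eq_bigr => i _; rewrite -[in RHS]fE h'E.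
Qed.

(* Truncating the geometric series at any order [N >= m] keeps everything
   inside {poly R}: h_m is read off the finite product. *)
Lemma hcomp_coef (R : comNzRingType) (N m : nat) (x : seq R) :
  (m <= N)%N -> hcomp m x = (\prod_(a <- x) geom_poly N a)`_m.
Proof.
move=> le_mN; rewrite (hcomp_ffun _ _ _ _ le_mN) [in RHS](big_nth 0) big_mkord.
rewrite bigA_distr_bigA coef_sum /= [LHS]big_mkcond /=.
apply: eq_bigr => f _; rewrite scaler_prod prodrXr coefZ coefXn eq_sym.
by case: eqP => _; rewrite ?mulr1 ?mulr0.
Qed.

Lemma hcomp_perm (R : comNzRingType) (m : nat) (x x' : seq R) :
  perm_eq x x' -> hcomp m x = hcomp m x'.
Proof.
by move=> xx'; rewrite !(hcomp_coef _ m) // (perm_big _ xx').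
Qed.

Lemma hcomp_nil (R : comNzRingType) (m : nat) :
  hcomp m ([::] : seq R) = (m == 0)%:R.
Proof. by rewrite (hcomp_coef _ m) // big_nil coef1. Qed.

Lemma hcomp0 (R : comNzRingType) (x : seq R) : hcomp 0 x = 1.
Proof.
rewrite (hcomp_coef _ 0) // -horner_coef0 horner_prod big1 // => a _.
by rewrite /geom_poly big_ord1 expr0 scale1r expr0 hornerC.
Qed.

(** Compare coefficients of degree [m.+1] in [(1 - a X) Q = (1 - (a X)^(m+2)) P]: truncation at
    order [m.+1] puts the error term one degree too high to matter. *)
Lemma hcomp_cons (R : comNzRingType) (m : nat) (a : R) (x : seq R) :
  hcomp m.+1 (a :: x) = hcomp m.+1 x + a * hcomp m (a :: x).
Proof.
rewrite !(hcomp_coef _ m.+1) //.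
set P := \prod_(b <- x) _; rewrite big_cons -/P.
set Q := geom_poly _ _ * P.
have : (1 - a *: 'X) * Q = (1 - (a *: 'X) ^+ m.+2) * P.
  by rewrite /Q mulrA geom_polyE.
move/(congr1 (fun p : {poly R} => p`_m.+1)).
rewrite !mulrBl !mul1r !coefB exprZn -!scalerAl !coefZ coefXM coefXnM ltnSn /=.
by rewrite mulr0 subr0 => <-; rewrite subrK.
Qed.

(** Pascal's rule, by induction on [k] and then on [m]. *)
Lemma hcomp_nseq (R : comNzRingType) (m k : nat) (a : R) :
  hcomp m (nseq k.+1 a) = 'C(m + k, k)%:R * a ^+ m.
Proof.
elim: k m => [|k IHk]; elim=> [|m IHm].
- by rewrite hcomp0 bin0 mulr1.
- by rewrite hcomp_cons hcomp_nil IHm !bin0 !mul1r add0r exprS.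
- by rewrite hcomp0 add0n binn mulr1.
- rewrite hcomp_cons (IHk m.+1) IHm.
  by rewrite [in RHS]addSn binS natrD mulrDl addSnnS addrC exprS mulrCA.
Qed.

(** * Lists with multiplicities, over all indices or all but one *)

Definition hmult {R : comNzRingType} {n : nat} (D : pred 'I_n)
    (kappa : 'I_n -> nat) (u : 'I_n -> R) (m : nat) : R :=
  hcomp m (flatten [seq nseq (kappa d) (u d) | d <- enum 'I_n & D d]).

(** A pointwise relation avoids both truncated subtraction and equality of functions. *)
Definition incr_at {n : nat} (b : 'I_n) (kappa' kappa : 'I_n -> nat) : Prop :=
  forall d, kappa d = (kappa' d + (d == b))%N.

Lemma hmult_rep_list (R : comNzRingType) (n : nat) (kappa : 'I_n -> nat)
    (u : 'I_n -> R) (m : nat) :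
  hcomp m (rep_list kappa u) = hmult predT kappa u m.
Proof. by rewrite /hmult filter_predT. Qed.

Lemma eq_hmult (R : comNzRingType) (n : nat) (D : pred 'I_n)
    (kappa kappa' : 'I_n -> nat) (u : 'I_n -> R) (m : nat) :
  {in D, kappa =1 kappa'} -> hmult D kappa u m = hmult D kappa' u m.
Proof.
move=> eqk; rewrite /hmult; congr (hcomp _ (flatten _)).
apply/eq_in_map => d; rewrite mem_filter => /andP[Dd _].
by rewrite eqk.
Qed.

Lemma hmult0 (R : comNzRingType) (n : nat) (D : pred 'I_n)
    (kappa : 'I_n -> nat) (u : 'I_n -> R) : hmult D kappa u 0 = 1.
Proof. exact: hcomp0. Qed.

(** By symmetry of [hcomp], one copy of [u b] can be moved to the front, where [hcomp_cons]
    applies. *)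
Lemma hmultS (R : comNzRingType) (n : nat) (D : pred 'I_n) (b : 'I_n)
    (kappa kappa' : 'I_n -> nat) (u : 'I_n -> R) (m : nat) :
  D b -> incr_at b kappa' kappa ->
  hmult D kappa u m.+1 = hmult D kappa' u m.+1 + u b * hmult D kappa u m.
Proof.
move=> Db kE; rewrite /hmult.
set s := flatten _; set s' := flatten [seq nseq (kappa' _) _ | _ <- _ & _].
suff ss' : perm_eq s (u b :: s').
  by rewrite !(hcomp_perm _ _ _ _ ss') hcomp_cons.
apply/permP => p; rewrite /= !count_flatten -!map_comp !sumnE !big_map.
rewrite !big_filter !big_enum_cond /= [LHS](bigD1 b) //= [in RHS](bigD1 b) //=.
rewrite !count_nseq kE eqxx addn1 mulnS -addnA; congr (_ + (_ + _))%N.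
by apply: eq_bigr => d /andP[_ /negPf db]; rewrite /= !count_nseq kE db addn0.
Qed.

Lemma hmult_cst (R : comNzRingType) (n : nat) (kappa : 'I_n -> nat)
    (s : 'I_n) (u : 'I_n -> R) (m : nat) :
  (0 < kappa s)%N -> (forall d, d != s -> kappa d = 0) ->
  hmult predT kappa u m = 'C(m + kappa s - 1, kappa s - 1)%:R * u s ^+ m.
Proof.
move=> ks_gt0 k0; rewrite /hmult.
have -> : flatten [seq nseq (kappa d) (u d) | d <- enum 'I_n & predT d]
          = nseq (kappa s) (u s).
  rewrite filter_predT; have: uniq (enum 'I_n) by exact: enum_uniq.
  have: s \in enum 'I_n by rewrite mem_enum.
  have nilP (e : seq 'I_n) : s \notin e ->
      flatten [seq nseq (kappa d) (u d) | d <- e] = [::].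
    elim: e => //= d e IHe; rewrite inE negb_or eq_sym.
    by move=> /andP[/k0-> /IHe->].
  elim: (enum 'I_n) => //= d e IHe; rewrite inE.
  have [<- _ /andP[se _]|sd /= se /andP[_ ue]] := eqVneq s d.
    by rewrite nilP // cats0.
  by rewrite k0 1?eq_sym // IHe.
by case: (kappa s) ks_gt0 => // k _; rewrite hcomp_nseq addnS !subn1.
Qed.

Lemma hmult_nil (R : comNzRingType) (n : nat) (D : pred 'I_n)
    (kappa : 'I_n -> nat) (u : 'I_n -> R) (m : nat) :
  (forall d, D d -> kappa d = 0) -> hmult D kappa u m = (m == 0)%:R.
Proof.
move=> k0; rewrite /hmult.
elim: (enum 'I_n) => [|d e IHe] /=; first exact: hcomp_nil.
by case Dd: (D d) => //=; rewrite k0.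
Qed.

(** * The exchange recurrence and the partial fraction expansion *)

Section PartialFractions.
Variables (K : fieldType) (n : nat) (y : 'I_n -> K).
Hypothesis y_inj : injective y.

Let u (s d : 'I_n) : K := y d / (y d - y s).
Let v (s d : 'I_n) : K := - y s / (y d - y s).

Let ysub_neq0 (s d : 'I_n) : d != s -> y d - y s != 0.
Proof. by rewrite subr_eq0 (inj_eq y_inj). Qed.

(* With u_d = y_d / (y_d - y_s), v_d is 1 - u_d, so A_{y,kappa,s,r} is the
   coefficient of t^(kappa_s - r) in
   prod_(d <> s) ((1 - u_d) / (1 - u_d t))^(kappa_d). *)
Lemma Acoef_hmult (kappa : 'I_n -> nat) (s : 'I_n) (r : nat) :
  Acoef y kappa s r =
  (\prod_(d < n | d != s) v s d ^+ kappa d)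
    * hmult (predC1 s) kappa (u s) (kappa s - r).
Proof.
rewrite /Acoef /hmult; congr (_ * _).
rewrite /hweight (bigD1 s) //= addKn -prodrXr -prodf_div.
by apply: eq_bigr => d _; rewrite expr_div_n.
Qed.

Lemma prod_incr (kappa kappa' : 'I_n -> nat) (s b : 'I_n) : b != s ->
  incr_at b kappa' kappa ->
  \prod_(d < n | d != s) v s d ^+ kappa d =
  v s b * \prod_(d < n | d != s) v s d ^+ kappa' d.
Proof.
move=> bs kE; rewrite (bigD1 b) //= [in RHS](bigD1 b) //= mulrA.
rewrite kE eqxx addn1 exprS; congr (_ * _).
by apply: eq_bigr => d /andP[_ /negPf db]; rewrite kE db addn0.
Qed.

Let exchange_mul2r (p q A1 A2 A3 c d : K) :
  (p - q) * A1 = p * A2 - q * A3 ->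
  (p - q) * (A1 * c * d) = p * (A2 * c * d) - q * (A3 * c * d).
Proof. by rewrite !mulrA => ->; rewrite !mulrBl. Qed.

Definition pf_term (kappa : 'I_n -> nat) (m : nat) (s : 'I_n) : K :=
  \sum_(1 <= r < (kappa s).+1)
     Acoef y kappa s r * 'C(m + r - 1, r - 1)%:R * y s ^+ m.

(** Holds for each [r] separately. Once every [hmult] is expressed through [kappa], it amounts to
    [(y_a - y_b) v_a v_b = y_a v_a - y_b v_b] and [y_a v_a u_b = y_b v_b u_a]. *)
Lemma pf_term_other (kappa ka kb k0 : 'I_n -> nat) (m : nat) (a b s : 'I_n) :
  a != b -> s != a -> s != b ->
  incr_at a ka kappa -> incr_at b kb kappa ->
  incr_at a k0 kb -> incr_at b k0 ka ->
  (y a - y b) * pf_term kappa m s = y a * pf_term kb m s - y b * pf_term ka m s.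
Proof.
move=> ab sa sb kaE kbE k0a k0b.
have kas : ka s = kappa s by rewrite kaE (negPf sa) addn0.
have kbs : kb s = kappa s by rewrite kbE (negPf sb) addn0.
rewrite /pf_term kas kbs !mulr_sumr -sumrB; apply: eq_bigr => r _.
apply: exchange_mul2r.
rewrite !Acoef_hmult kas kbs.
have as_ : a != s by rewrite eq_sym.
have bs_ : b != s by rewrite eq_sym.
rewrite (prod_incr kappa kb s b) // (prod_incr kb k0 s a) //.
rewrite (prod_incr ka k0 s b) //.
set P := \prod_(d < n | _) _.
have ya := ysub_neq0 s a as_; have yb := ysub_neq0 s b bs_.
case: (kappa s - r)%N => [|j].
  by rewrite !hmult0 /v; field; rewrite ya yb.
have Hb := hmultS _ _ (predC1 s) b kappa kb (u s) j bs_ kbE.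
have Ha := hmultS _ _ (predC1 s) a kappa ka (u s) j as_ kaE.
move/eqP: Ha; rewrite -subr_eq => /eqP <-.
move/eqP: Hb; rewrite -subr_eq => /eqP <-.
by rewrite /v /u; field; rewrite ya yb.
Qed.

Lemma pf_term_same (kappa ka kb : 'I_n -> nat) (m : nat) (a b : 'I_n) :
  a != b -> incr_at a ka kappa -> incr_at b kb kappa ->
  (y a - y b) * pf_term kappa m a = y a * pf_term kb m a - y b * pf_term ka m a.
Proof.
move=> ab kaE kbE.
have kae : kappa a = (ka a).+1 by rewrite kaE eqxx addn1.
have kbe : kb a = (ka a).+1 by rewrite -kae kbE (negPf ab) addn0.
have ba : b != a by rewrite eq_sym.
have yb := ysub_neq0 a b ba.
have eqka : {in predC1 a, ka =1 kappa}.
  by move=> d; rewrite inE => /negPf da; rewrite kaE da addn0.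
(* The index [r = kappa a] is split off, since the sum for [ka] stops just below it. There only
   [(y_a - y_b) v_b = y_a] is needed. *)
rewrite /pf_term kae kbe !(big_nat_recr (ka a).+1) //= !mulrDr.
rewrite addrAC; congr (_ + _); last first.
  do 2![rewrite [LHS]mulrA [RHS]mulrA; congr (_ * _)].
  rewrite !Acoef_hmult kae kbe !subnn !hmult0 (prod_incr kappa kb a b) //.
  by rewrite /v; field.
(* For smaller [r], lowering [kappa a] lowers the degree of [hmult] by one and leaves its list
   unchanged, so [hmultS] at [b] links the three terms. *)
rewrite !mulr_sumr -sumrB; apply: eq_big_nat => r /andP[r_gt0 r_le].
apply: exchange_mul2r.
rewrite !Acoef_hmult kae kbe subSn //.
rewrite (hmultS _ _ (predC1 a) b kappa kb) //.
rewrite (eq_hmult _ _ (predC1 a) ka kappa) //.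
have -> : \prod_(d < n | d != a) v a d ^+ ka d
          = \prod_(d < n | d != a) v a d ^+ kappa d.
  by apply: eq_bigr => d da; rewrite eqka.
rewrite (prod_incr kappa kb a b) //.
by rewrite /v /u; field.
Qed.

(** The list in [Acoef] at [s] is empty, so only the degree zero term [r = kappa s] survives. *)
Lemma pf_term_base (kappa : 'I_n -> nat) (m : nat) (s : 'I_n) :
  (0 < kappa s)%N -> (forall d, d != s -> kappa d = 0) ->
  \sum_(d < n) pf_term kappa m d =
  'C(m + kappa s - 1, kappa s - 1)%:R * y s ^+ m.
Proof.
move=> ks_gt0 k0; rewrite (bigD1 s) //= [X in _ + X]big1 ?addr0; last first.
  by move=> d ds; rewrite /pf_term k0 // big_geq.
rewrite /pf_term big_nat_recr //= big_nat_cond big1 ?add0r => [|r].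
  rewrite Acoef_hmult subnn hmult0 mulr1 big1 ?mul1r // => d ds.
  by rewrite k0.
rewrite andbT => /andP[_ r_lt]; rewrite Acoef_hmult hmult_nil //.
by rewrite subn_eq0 leqNgt r_lt mulr0 !mul0r.
Qed.

Lemma hmult_exchange (kappa ka kb : 'I_n -> nat) (m : nat) (a b : 'I_n) :
  incr_at a ka kappa -> incr_at b kb kappa ->
  (y a - y b) * hmult predT kappa y m =
  y a * hmult predT kb y m - y b * hmult predT ka y m.
Proof.
move=> kaE kbE; case: m => [|m]; first by rewrite !hmult0 !mulr1.
have /eqP := hmultS _ _ predT a kappa ka y m isT kaE.
rewrite -subr_eq => /eqP <-.
have /eqP := hmultS _ _ predT b kappa kb y m isT kbE.
by rewrite -subr_eq => /eqP <-; ring.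
Qed.

(** The positive entry excludes [kappa = 0], where for [m = 0] the left side is 1 and the right side
    0. The induction preserves it: [kb] keeps entry [a] positive and [ka] keeps entry [b]. *)
Lemma hcomp_partial_fractions (kappa : 'I_n -> nat) (s0 : 'I_n) (m : nat) :
  (0 < kappa s0)%N ->
  hcomp m (rep_list kappa y) = \sum_(s < n) pf_term kappa m s.
Proof.
rewrite hmult_rep_list; have [w] := ubnP (\sum_(d < n) kappa d)%N.
elim: w kappa s0 => // w IHw kappa a; rewrite ltnS => k_le ka_gt0.
have decr c : (0 < kappa c)%N -> exists k', incr_at c k' kappa.
  move=> kc; exists (fun d => kappa d - (d == c))%N => d.
  by case: eqP => [->|_]; rewrite ?subn0 ?addn0 // subn1 addn1 prednK.
have decr_lt c k' : incr_at c k' kappa -> (\sum_(d < n) k' d < w)%N.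
  move=> kE; apply: leq_trans k_le.
  rewrite (eq_bigr _ (fun d _ => kE d)) big_split /= -addn1 leq_add2l.
  by rewrite (bigD1 c) //= eqxx leq_addr.
case: (pickP [pred b | (b != a) && (0 < kappa b)%N]) => [b|k0]; last first.
  have {}k0 d : d != a -> kappa d = 0.
    by move=> da; move: (k0 d); rewrite /= da lt0n => /negbFE/eqP.
  by rewrite (hmult_cst _ _ _ a) // (pf_term_base _ _ a).
move=> /andP[ba kb_gt0]; have ab : a != b by rewrite eq_sym.
have [ka kaE] := decr a ka_gt0; have [kb kbE] := decr b kb_gt0.
have kba : (0 < kb a)%N by move: ka_gt0; rewrite kbE (negPf ab) addn0.
have kab : (0 < ka b)%N by move: kb_gt0; rewrite kaE (negPf ba) addn0.
(* Both entries lowered: the common part of [ka] and [kb], required when [s] is neither [a] nor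
   [b]. *)
pose k0 d := (ka d - (d == b))%N.
have k0b : incr_at b k0 ka.
  move=> d; rewrite /k0.
  by case: eqP => [->|_]; rewrite ?subn0 ?addn0 // subn1 addn1 prednK.
have k0a : incr_at a k0 kb.
  move=> d; apply/eqP; rewrite -(eqn_add2r (d == b)) -kbE addnAC -k0b.
  by rewrite -kaE.
apply: (mulfI (ysub_neq0 b a ab)).
rewrite (hmult_exchange kappa ka kb) //.
rewrite (IHw kb a) ?(decr_lt b) // (IHw ka b) ?(decr_lt a) //.
rewrite !mulr_sumr -sumrB; apply: eq_bigr => s _; apply/esym.
have [->|sa] := eqVneq s a; first exact: pf_term_same.
have [->|sb] := eqVneq s b; last exact: (pf_term_other _ _ _ k0).
(* For [s = b] the roles of [a] and [b] are swapped, which negates both sides. *)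
by apply: oppr_inj; rewrite -mulNr !opprB (pf_term_same _ kb ka).
Qed.

End PartialFractions.

Theorem theorem9p1 (F : fieldType) (F_char0 : [pchar F] =i pred0)
    (n : nat) (n_gt0 : (0 < n)%N)
    (kappa : 'I_n -> nat) (kappa_gt0 : forall j : 'I_n, (0 < kappa j)%N)
    (m : nat) :
  (let y : 'I_n -> {fraction {mpoly F[n]}} :=
     fun i => @FracField.tofrac {mpoly F[n]} 'X_i in
   hcomp m (rep_list kappa y) =
     \sum_(s < n) \sum_(1 <= r < (kappa s).+1)
        Acoef y kappa s r * 'C(m + r - 1, r - 1)%:R * y s ^+ m)
  /\
  (forall y : 'I_n -> F, (forall i j : 'I_n, i <> j -> y i <> y j) ->
   hcomp m (rep_list kappa y) =
     \sum_(s < n) \sum_(1 <= r < (kappa s).+1)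
        Acoef y kappa s r * 'C(m + r - 1, r - 1)%:R * y s ^+ m).
Proof.
split=> [y|y y_inj].
  apply: (hcomp_partial_fractions _ _ y _ _ (Ordinal n_gt0)) => // i j /eqP.
  (* Distinct indeterminates differ in their coefficient at [U_(j)]. *)
  rewrite /y tofrac_eq => /eqP/(congr1 (mcoeff U_(j))).
  rewrite !mcoeffX eqxx; have [//|ij] := eqVneq i j.
  rewrite (_ : (U_(i)%MM == U_(j)%MM) = false) => [/eqP|].
    by rewrite eq_sym oner_eq0.
  apply/negP => /eqP/mnmP/(_ j); rewrite !mnm1E eqxx (negPf ij) //.
apply: (hcomp_partial_fractions _ _ y _ _ (Ordinal n_gt0)) => // i j yij.
by apply/eqP; apply: contra_eqT yij => /eqP/y_inj/eqP.
Qed.
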